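(* Let $M_i$, $i\in N$, be real coefficients that are sufficiently large in the sense that $\Phi_F(w)=\max_{x\in X}\{\Phi_I(x)-\sum_{i\in N}M_i x_i w_i\}$ for all $w\in W$, so that the fortification game is the problem of minimizing $\theta$ over $w\in W$, $\theta\in\mathbb{R}$ subject to $$\theta \ge \Phi_I(\hat x)-\sum_{i\in N} M_i\hat x_i w_i\qquad \forall \hat x\in X. \quad ( * )$$ Then the constraints $( * )$ can be replaced with the fortification cuts $$\theta \ge \Phi_I(\hat x)-\sum_{i\in N} d_i\hat x_i w_i\qquad \forall \hat x\in X. \quad ( ** )$$ That is, for every $w\in W$ and $\theta\in\mathbb{R}$, the pair $(w,\theta)$ satisfies all constraints $( * )$ if and only if it satisfies all constraints $( ** )$; in particular $$z^*=\min\Big\{\theta \;:\; w\in W,\ \theta\in\mathbb{R},\ \theta \ge \Phi_I(\hat x)-\sum_{i\in N} d_i\hat x_i w_i\ \ \forall \hat x\in X\Big\}.$$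
   Context: Let $N$ be a finite set of assets, $n=|N|$. For each $i\in N$ let $f_i\ge 0$ be a fortification cost, $g_i\ge 0$ an interdiction cost, and $d_i\ge 0$ a depreciation; let $B_F\ge 0$ and $B_I\ge 0$ be the fortification and interdiction budgets. Let $c\in\mathbb{R}^n$ and let $Y\subseteq\{0,1\}^n$ be nonempty (the feasible set of the recourse problem). Define - $W=\{w\in\{0,1\}^n:\sum_{i\in N} f_i w_i\le B_F\}$ (feasible fortification strategies), - $X=\{x\in\{0,1\}^n:\sum_{i\in N} g_i x_i\le B_I\}$ (interdiction strategies), - $X(w)=\{x\in X: x_i\le 1-w_i\ \forall i\in N\}$ for $w\in W$, - $\Phi_I(x)=\min_{y\in Y}\{c^Ty+\sum_{i\in N} d_i x_i y_i\}$ for $x\in X$, - $\Phi_F(w)=\max_{x\in X(w)}\Phi_I(x)$ for $w\in W$. The fortification game is $z^*=\min_{w\in W}\max_{x\in X(w)}\min_{y\in Y}\{c^Ty+\sum_{i\in N} d_i x_i y_i\}=\min_{w\in W}\Phi_F(w)$. *)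

(* Defs.v *)
From mathcomp Require Import all_boot all_order all_algebra.
From mathcomp Require Import classical_sets reals.

Set Implicit Arguments.
Unset Strict Implicit.
Unset Printing Implicit Defensive.

Import Order.TTheory GRing.Theory Num.Theory.
Local Open Scope set_scope.
Local Open Scope ring_scope.

Section FiniteOptima.
Context {R : realType} {T : finType}.

(* The value 0 on the empty set is a junk value. *)
Definition min_over (A : {set T}) (F : T -> R) : R :=
  if [pick a in A] is Some a0 then F [arg min_(a < a0 in A) F a]%O else 0.

Definition max_over (A : {set T}) (F : T -> R) : R :=
  if [pick a in A] is Some a0 then F [arg max_(a > a0 in A) F a]%O else 0.

End FiniteOptima.

Definition is_minimum {R : realType} (S : set R) (m : R) : Prop :=
  S m /\ lbound S m.

(* The points of {0,1}^N are boolean vectors; as a real number, the i-th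
   coordinate of x is (x i)%:R. *)
Notation binvec N := {ffun N -> bool}.

Section FortificationGame.
Context {R : realType} {N : finType}.

Definition fortifications (f : N -> R) (BF : R) : {set binvec N} :=
  [set w : binvec N | \sum_i f i * (w i)%:R <= BF].

Definition interdictions (g : N -> R) (BI : R) : {set binvec N} :=
  [set x : binvec N | \sum_i g i * (x i)%:R <= BI].

Definition interdictions_against (g : N -> R) (BI : R) (w : binvec N) :
    {set binvec N} :=
  [set x in interdictions g BI | [forall i, (x i)%:R <= 1 - (w i)%:R :> R]].

Definition PhiI (c d : N -> R) (Y : {set binvec N}) (x : binvec N) : R :=
  min_over Y (fun y => \sum_i c i * (y i)%:R
                       + \sum_i d i * (x i)%:R * (y i)%:R).

Definition PhiF (g : N -> R) (BI : R) (c d : N -> R) (Y : {set binvec N})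
    (w : binvec N) : R :=
  max_over (interdictions_against g BI w) (PhiI c d Y).

Definition zstar (f : N -> R) (BF : R) (g : N -> R) (BI : R) (c d : N -> R)
    (Y : {set binvec N}) : R :=
  min_over (fortifications f BF) (PhiF g BI c d Y).

End FortificationGame.

(* Main.v *)
(* At a fixed w, each family of cuts is equivalent to theta >= Phi_F(w).  For
   the d-cuts: if x in X(w) then the correction term vanishes; conversely,
   removing the fortified assets from x in X gives x' in X(w), and each removed
   asset i lowers the recourse objective by at most d_i, whatever y is. *)
Require Import Defs.
From mathcomp Require Import all_boot all_order all_algebra.
From mathcomp Require Import classical_sets reals.

Set Implicit Arguments.
Unset Strict Implicit.
Unset Printing Implicit Defensive.

Import Order.TTheory GRing.Theory Num.Theory.
Local Open Scope ring_scope.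

(** Non-emptiness excludes the junk value 0: over an empty [A] the right-hand side would hold
    vacuously for every [t]. *)
Lemma max_over_leP (R : realType) (T : finType) (A : {set T}) (F : T -> R)
    (t : R) :
  A != finset.set0 ->
  max_over A F <= t <-> (forall a, a \in A -> F a <= t).
Proof.
rewrite /max_over; case: pickP => [a0 a0A _|A0 /set0Pn[a]]; last by rewrite A0.
case: arg_maxP => // a aA a_max; split=> [le_t b bA|]; last exact.
exact: le_trans (a_max b bA) le_t.
Qed.

Lemma min_over_attained (R : realType) (T : finType) (A : {set T})
    (F : T -> R) :
  A != finset.set0 -> exists2 a, a \in A & min_over A F = F a.
Proof.
rewrite /min_over; case: pickP => [a0 a0A _|A0 /set0Pn[a]]; last by rewrite A0.
by case: arg_minP => // a aA _; exists a.
Qed.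

Lemma min_over_le (R : realType) (T : finType) (A : {set T}) (F : T -> R) a :
  a \in A -> min_over A F <= F a.
Proof.
rewrite /min_over; case: pickP => [a0 a0A|A0]; last by rewrite A0.
by case: arg_minP => // b _ b_min /b_min.
Qed.

(** The zero vector costs nothing. This serves both $W$ and $X$, so the optima over them are
    genuine. *)
Lemma budget_neq0 (R : realType) (N : finType) (a : N -> R) (B : R) :
  0 <= B -> [set x : binvec N | \sum_i a i * (x i)%:R <= B] != finset.set0.
Proof.
move=> B_ge0; apply/set0Pn; exists [ffun=> false]; rewrite inE big1 // => i _.
by rewrite ffunE mulr0.
Qed.

Section Cuts.
Context {R : realType} {N : finType}.
Implicit Types (g c d : N -> R) (w x : binvec N) (Y : {set binvec N}).

Definition unfortified w x : binvec N := [ffun i => x i && ~~ w i].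

Lemma interdictions_againstE g BI w x :
  (x \in interdictions_against g BI w) =
  (x \in interdictions g BI) && [forall i, x i ==> ~~ w i].
Proof.
rewrite inE; congr (_ && _); apply: eq_forallb => i.
by case: (x i); case: (w i); rewrite ?subrr ?subr0 ?lexx ?ler01 ?ler10.
Qed.

(** As [g] is nonnegative, dropping assets from an attack keeps it within budget. *)
Lemma unfortified_against g BI w x :
  (forall i, 0 <= g i) -> x \in interdictions g BI ->
  unfortified w x \in interdictions_against g BI w.
Proof.
move=> g_ge0; rewrite interdictions_againstE !inE => x_le; apply/andP; split.
  apply: le_trans x_le; apply: ler_sum => i _; rewrite ffunE.
  by apply: ler_wpM2l => //; case: (x i); case: (w i).
by apply/forallP => i; rewrite ffunE; case: (x i); case: (w i).
Qed.

Lemma PhiI_unfortified c d Y w x :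
  (forall i, 0 <= d i) -> Y != finset.set0 ->
  PhiI c d Y x - \sum_i d i * (x i)%:R * (w i)%:R
    <= PhiI c d Y (unfortified w x).
Proof.
move=> d_ge0 Y_neq0; rewrite lerBlDr /PhiI.
(* Take [y] optimal against the reduced attack. Since $Y$ does not depend on the attack, [y] is also
   a candidate against [x] and bounds [PhiI c d Y x] from above. *)
have [y yY ->] := min_over_attained
  (fun y : binvec N => \sum_i c i * (y i)%:R
                       + \sum_i d i * (unfortified w x i)%:R * (y i)%:R) Y_neq0.
apply: le_trans (min_over_le _ yY) _.
rewrite -addrA lerD2l -big_split /=; apply: ler_sum => i _; rewrite ffunE.
(* With $d_i \ge 0$ factored out, what remains is $x_i y_i \le x_i (1 - w_i) y_i + x_i w_i$: an
   equality if $w_i = 0$, and $x_i y_i \le x_i$ if $w_i = 1$. *)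
rewrite -!mulrA -mulrDr; apply: ler_wpM2l => //.
by case: (x i); case: (w i); case: (y i);
  rewrite /= ?(mulr0, mul0r, mulr1, addr0, add0r).
Qed.

Lemma fortification_cutsP g BI c d Y w (theta : R) :
  (forall i, 0 <= g i) -> (forall i, 0 <= d i) -> 0 <= BI ->
  Y != finset.set0 ->
  (forall x, x \in interdictions g BI ->
     PhiI c d Y x - \sum_i d i * (x i)%:R * (w i)%:R <= theta)
  <-> PhiF g BI c d Y w <= theta.
Proof.
move=> g_ge0 d_ge0 BI_ge0 Y_neq0.
have Xw_neq0 : interdictions_against g BI w != finset.set0.
  have /set0Pn[x xX] := budget_neq0 g BI_ge0.
  by apply/set0Pn; exists (unfortified w x); apply: unfortified_against.
rewrite /PhiF max_over_leP //; split=> [cuts x|PhiI_le x xX].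
  rewrite interdictions_againstE => /andP[/cuts + /forallP x_w].
  (* An attack in $X(w)$ has $x_i w_i = 0$ for every $i$, so its cut reads $\Phi_I(x) \le
     \theta$. *)
  rewrite big1 ?subr0 // => i _; have := x_w i.
  by case: (x i); case: (w i); rewrite ?mulr0 ?mul0r.
exact: le_trans (PhiI_unfortified c w x d_ge0 Y_neq0)
  (PhiI_le _ (unfortified_against w g_ge0 xX)).
Qed.

End Cuts.

Theorem theorem1 (R : realType) (N : finType)
    (f g d c : N -> R) (BF BI : R) (Y : {set binvec N}) (M : N -> R)
    (f_ge0 : forall i, 0 <= f i) (g_ge0 : forall i, 0 <= g i)
    (d_ge0 : forall i, 0 <= d i) (BF_ge0 : 0 <= BF) (BI_ge0 : 0 <= BI)
    (Y_neq0 : Y != finset.set0)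
    (M_large : forall w : binvec N, w \in fortifications f BF ->
       PhiF g BI c d Y w =
       max_over (interdictions g BI)
         (fun x => PhiI c d Y x - \sum_i M i * (x i)%:R * (w i)%:R)) :
  (forall (w : binvec N) (theta : R), w \in fortifications f BF ->
     (forall x, x \in interdictions g BI ->
        theta >= PhiI c d Y x - \sum_i M i * (x i)%:R * (w i)%:R)
     <->
     (forall x, x \in interdictions g BI ->
        theta >= PhiI c d Y x - \sum_i d i * (x i)%:R * (w i)%:R))
  /\
  is_minimum
    [set theta : R | exists2 w : binvec N, w \in fortifications f BF &
       forall x, x \in interdictions g BI ->
         theta >= PhiI c d Y x - \sum_i d i * (x i)%:R * (w i)%:R]%classic
    (zstar f BF g BI c d Y).
Proof.
split=> [w theta wW|].
  (* [M_large] writes $\Phi_F(w)$ as the maximum over $X$ of the right-hand sides of the M-cuts, so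
     both families say $\Phi_F(w) \le \theta$. *)
  rewrite fortification_cutsP // M_large // max_over_leP //.
  exact: budget_neq0.
split=> [|theta [w wW]] /=.
  (* A minimizer [w] of $\Phi_F$ over $W$ makes $\theta = z^*$ feasible; conversely, any feasible
     pair has $\theta \ge \Phi_F(w) \ge z^*$. *)
  have [w wW zw] := min_over_attained (PhiF g BI c d Y) (budget_neq0 f BF_ge0).
  by exists w => //; apply/fortification_cutsP; rewrite // /zstar zw.
by move/fortification_cutsP => PhiF_le; apply: le_trans (PhiF_le _ _ _ _);
  rewrite // /zstar min_over_le.
Qed.
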